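(* Let $G$ be a connected graph of order $n$ and let $k$ be an integer such that $3\leq k\leq n$. Then $\kappa_k(G)=n-\lceil\frac{k}{2}\rceil$ if and only if the following holds: $G=K_n$ if $k$ is even; and $G=K_n\setminus M$ for some edge set $M\subseteq E(K_n)$ with $0\leq |M|\leq \frac{k-1}{2}$ if $k$ is odd.
   Context: All graphs are undirected, finite and simple. For a graph $G$ and a set $S\subseteq V(G)$ of at least two vertices, a tree connecting $S$ is a subgraph $T$ of $G$ that is a tree with $S\subseteq V(T)$. Two trees $T,T'$ connecting $S$ are internally disjoint if $E(T)\cap E(T')=\varnothing$ and $V(T)\cap V(T')=S$. Let $\kappa(S)$ be the maximum number of pairwise internally disjoint trees connecting $S$ in $G$. The generalized $k$-connectivity of $G$ is $\kappa_k(G)=\min\{\kappa(S) : S\subseteq V(G),\ |S|=k\}$. $K_n$ is the complete graph of order $n$, and $K_n\setminus M$ is the graph obtained from $K_n$ by deleting the edges of $M$ (keeping all vertices). Equality of graphs is understood up to isomorphism. *)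

(* Defs.v *)
From mathcomp Require Import all_boot.
Set Implicit Arguments.
Unset Strict Implicit.
Unset Printing Implicit Defensive.

Record sgraph := SGraph {
  vertex :> finType;
  adj : rel vertex;
  adj_sym : symmetric adj;
  adj_irrefl : irreflexive adj }.

Definition edges (G : sgraph) : {set {set G}} :=
  [set [set p.1; p.2] | p : G * G & adj p.1 p.2].

Definition isomorphic (G H : sgraph) : Prop :=
  exists2 f : G -> H, bijective f & forall x y, adj (f x) (f y) = adj x y.

Section Relations.
Variables (V : finType) (r : rel V).

Definition connected_on (A : {set V}) : bool :=
  (A != set0) && [forall x in A, forall y in A, connect r x y].

(* A cycle is a duplicate-free cyclic sequence of at least three vertices, so
   its length is at most #|V|; see acyclicP for the unbounded form. *)
Definition acyclic : bool :=
  [forall m : 'I_#|V|.+1, forall c : m.-tuple V, ~~ ((2 < m) && ucycleb r c)].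

Lemma acyclicP :
  reflect (forall c : seq V, 2 < size c -> ~ ucycle r c) acyclic.
Proof.
apply: (iffP forallP) => [H c c2 cyc | H m].
  have sz : size c < #|V|.+1.
    by case/andP: cyc => _ /card_uniqP <-; rewrite ltnS max_card.
  have /forallP/(_ (in_tuple c)) := H (Ordinal sz).
  by rewrite /= c2 => /negP; apply.
apply/forallP => c; apply/negP => /andP[m2]; apply: H.
by rewrite size_tuple.
Qed.
End Relations.

Definition connected (G : sgraph) : bool := connected_on (@adj G) [set: G].

Definition complete_rel n : rel 'I_n := fun x y => x != y.
Arguments complete_rel : clear implicits.

Lemma complete_sym n : symmetric (complete_rel n).
Proof. by move=> x y; rewrite /complete_rel eq_sym. Qed.

Lemma complete_irrefl n : irreflexive (complete_rel n).
Proof. by move=> x; rewrite /complete_rel eqxx. Qed.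

Definition complete n := SGraph (@complete_sym n) (@complete_irrefl n).

Section DeleteEdges.
Variables (G : sgraph) (M : {set {set G}}).

Definition del_rel : rel G := fun x y => adj x y && ([set x; y] \notin M).

Lemma del_sym : symmetric del_rel.
Proof. by move=> x y; rewrite /del_rel adj_sym setUC. Qed.

Lemma del_irrefl : irreflexive del_rel.
Proof. by move=> x; rewrite /del_rel adj_irrefl. Qed.

Definition del_edges := SGraph del_sym del_irrefl.
End DeleteEdges.

Section GeneralizedConnectivity.
Variable G : sgraph.

(* A candidate subgraph is a pair (vertex set, edge set). *)
Definition presubgraph := ({set G} * {set {set G}})%type.

Definition is_subgraph (T : presubgraph) : bool :=
  (T.2 \subset edges G) && [forall e in T.2, e \subset T.1].

Definition sub_adj (T : presubgraph) : rel G := fun x y => [set x; y] \in T.2.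

Definition is_tree (T : presubgraph) : bool :=
  connected_on (sub_adj T) T.1 && acyclic (sub_adj T).

Definition connecting_tree (S : {set G}) (T : presubgraph) : bool :=
  [&& is_subgraph T, is_tree T & S \subset T.1].

Definition internally_disjoint (S : {set G}) (T T' : presubgraph) : bool :=
  (T.2 :&: T'.2 == set0) && (T.1 :&: T'.1 == S).

(* For #|S| >= 2 connecting trees have edges, so edge-disjoint trees are
   distinct and a set of trees carries as much as an indexed family. *)
Definition tree_packing (S : {set G}) (F : {set presubgraph}) : bool :=
  [forall T in F, connecting_tree S T] &&
  [forall T in F, forall T' in F, (T != T') ==> internally_disjoint S T T'].

Definition kappa (S : {set G}) : nat :=
  \max_(F : {set presubgraph} | tree_packing S F) #|F|.

(* Taking the maximum as the starting value makes this the true minimum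
   whenever k <= #|G|; see gen_connectivityP. *)
Definition gen_connectivity (k : nat) : nat :=
  \big[minn/(\max_(S : {set G} | #|S| == k) kappa S)]_(S : {set G} | #|S| == k)
     kappa S.

Lemma gen_connectivityP k : k <= #|G| ->
  (exists2 S : {set G}, #|S| = k & gen_connectivity k = kappa S) /\
  (forall S : {set G}, #|S| = k -> gen_connectivity k <= kappa S).
Proof.
move=> kG; split; last first.
  move=> S /eqP Sk; rewrite /gen_connectivity; set b := \max_(_ | _) _.
  have: S \in index_enum {set G} by rewrite mem_index_enum.
  elim: (index_enum _) => // S' s IH; rewrite inE big_cons.
  case/orP => [/eqP <- | /IH le]; first by rewrite Sk geq_minl.
  by case: ifP => // _; rewrite (leq_trans (geq_minr _ _)).
have [A] : exists A : {set G}, #|A| == k.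
  exists [set x in take k (enum G)].
  rewrite cardsE (card_uniqP _) ?take_uniq ?enum_uniq //.
  by rewrite size_takel // -cardE.
move=> Ak; pose P m := exists2 S : {set G}, #|S| = k & m = kappa S.
rewrite -/(P _) /gen_connectivity; apply: big_ind => [|m1 m2 P1 P2|S /eqP Sk].
- rewrite (bigmax_eq_arg _ Ak); case: arg_maxnP => // S /eqP Sk _.
  by exists S.
- by rewrite /minn; case: ifP.
- by exists S.
Qed.
End GeneralizedConnectivity.

(* Main.v *)
(** Let [q = k./2], and let [S] be a set of [k] vertices of [G].

    Upper bound.  A tree connecting [S] has at least [k - 1] edges meeting [S],
    and at least [k] if it has a vertex outside [S]; there are at most [n - k]
    trees of the latter kind, and at most [q] inside [S] because [S] spans at
    most [k (k - 1) / 2] edges.  If both bounds are attained, counting the edges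
    meeting [S] leaves room for no missing edge meeting [S] if [k] is even and
    for at most [q] if [k] is odd; [S] can be chosen to meet as many missing
    edges as one needs.

    Lower bound.  The vertices [w] outside [S] are the centres of stars.  When
    [w] misses [s] in [S], the star is completed by an edge from [s] to a vertex
    of [S] incident with no missing edge, distinct [w] using distinct targets.
    For odd [k] this costs at most [q] edges inside [S] in total, counting the
    edges missing there, and [K_(2q+1)] minus any [q] edges contains [q]
    edge-disjoint spanning trees, by an induction removing two vertices. *)
Require Import Defs.
From mathcomp Require Import all_boot zify.
Set Implicit Arguments.
Unset Strict Implicit.
Unset Printing Implicit Defensive.

(** * Trees grown by adding leaves *)

Section GrownTrees.
Variable V : finType.
Implicit Types (A B S : {set V}) (E : {set {set V}}).

(** Trees are built in this form so that acyclicity is proved once, in [grown_tree], and not for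
    each construction. *)
Inductive grown : {set V} -> {set {set V}} -> Prop :=
| Grown1 x : grown [set x] set0
| GrownLeaf A E x y : grown A E -> x \in A -> y \notin A ->
    grown (y |: A) ([set x; y] |: E).

Lemma grown_edge A E e : grown A E -> e \in E -> (#|e| == 2) && (e \subset A).
Proof.
move=> gAE; elim: gAE e => [x|{}A {}E x y _ IH xA yA] e; first by rewrite inE.
rewrite !inE => /orP[/eqP -> | /IH /andP[-> eA]]; last first.
  exact: subset_trans eA (subsetUr _ _).
have xy : x != y by apply: contraNneq yA => <-.
by rewrite cards2 xy subUset !sub1set !inE eqxx xA orbT.
Qed.

(** The parents [f y] lie in the old set [A], so the new leaves can be attached in any order; from a
    single vertex this builds stars. *)
Lemma grown_leaves A B E (f : V -> V) : grown A E ->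
  {in B, forall y, (f y \in A) && (y \notin A)} ->
  grown (A :|: B) (E :|: [set [set f y; y] | y in B]).
Proof.
move=> gAE; have [m] := ubnP #|B|; elim: m B => // m IH B cB fB.
have [->|[y yB]] := set_0Vmem B; first by rewrite imset0 !setU0.
have [fyA yA] := andP (fB y yB).
rewrite -(setD1K yB) imsetU1 !(setUCA _ [set _]).
apply: GrownLeaf; last by rewrite !inE eqxx (negPf yA).
  apply: IH => [|z]; last by rewrite !inE => /andP[_ /fB].
  by move: cB; rewrite (cardsD1 y) yB.
by rewrite inE fyA.
Qed.

Lemma crossing (r : rel V) B x y :
  connect r x y -> x \in B -> y \notin B ->
  exists a b, [/\ a \in B, b \notin B & r a b].
Proof.
case/connectP=> p; elim: p x => [|z p IH] x /=; first by move=> _ -> ->.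
case/andP=> rxz pz yl xB yB; case: (boolP (z \in B)) => zB; last by exists x, z.
exact: IH pz yl zB yB.
Qed.

(* Growing a connected graph from x0, each vertex of S reached brings in an
   edge of its own that meets S. *)
Lemma connected_edges_meeting A E S x0 :
  connected_on (fun x y => [set x; y] \in E) A -> x0 \in A -> S \subset A ->
  {in E, forall e : {set V}, e \subset A} ->
  #|S :\ x0| <= #|[set e in E | e :&: S != set0]|.
Proof.
case/andP=> _ /forall_inP con x0A SA EA.
(* [B] is the part reached so far. Only edges inside [B] are counted, so an edge leaving [B] is
   always new. *)
suff grow j : j < #|A| -> exists2 B : {set V}, (x0 \in B) && (B \subset A) &
    j < #|B| /\ #|(S :&: B) :\ x0| <=
      #|[set e in E | (e :&: S != set0) && (e \subset B)]|.
  have A0 : 0 < #|A| by apply/card_gt0P; exists x0.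
  have [|B /andP[_ BA] [lB le]] := grow #|A|.-1; first by rewrite prednK.
  have {}BA : B = A by apply/eqP; rewrite eqEcard BA; lia.
  rewrite BA (setIidPl SA) in le; apply: leq_trans le _; apply: subset_leq_card.
  by apply/subsetP => e; rewrite !inE => /and3P[-> ->].
elim: j => [|j IH] jA.
  exists [set x0]; rewrite ?inE ?eqxx ?sub1set // cards1; split=> //.
  by rewrite (_ : _ :\ _ = set0) ?cards0 //; apply/setP => x; rewrite !inE; case: (x == x0); rewrite ?andbF.
have [B /andP[x0B BA] [jB le]] := IH (ltnW jA).
have [lB|lB] := leqP j.+2 #|B|; first by exists B; rewrite ?x0B.
have /subsetPn[y yA yB] : ~~ (A \subset B).
  by apply/negP => /subset_leq_card; lia.
have xy : connect (fun x y => [set x; y] \in E) x0 y by have /forall_inP := con _ x0A; apply.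
have [a [b [aB bB abE]]] := crossing xy x0B yB.
have bA : b \in A by apply: (subsetP (EA _ abE)); rewrite !inE eqxx orbT.
exists (b |: B); first by rewrite !inE x0B orbT subUset sub1set bA.
split; first by rewrite cardsU1 bB.
have bx0 : b != x0 by apply: contraNneq bB => ->.
have sub : [set e in E | (e :&: S != set0) && (e \subset B)] \subset
   [set e in E | (e :&: S != set0) && (e \subset b |: B)].
  apply/subsetP => e; rewrite !inE => /and3P[-> -> eB] /=.
  exact: subset_trans eB (subsetUr _ _).
have [bS|bS] := boolP (b \in S); last first.
  apply: leq_trans (subset_leq_card sub); apply: leq_trans le.
  apply: subset_leq_card; apply/subsetP => x; rewrite !inE.
  by case: eqP bS => //= _; case: eqP => // ->; move/negPf ->.
apply: (@leq_trans #|b |: ((S :&: B) :\ x0)|).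
  apply: subset_leq_card; apply/subsetP => x; rewrite !inE.
  by case: (x == x0); case: (x == b); case: (x \in S).
apply: (@leq_trans #|[set a; b] |: [set e in E | (e :&: S != set0) && (e \subset B)]|).
  rewrite !cardsU1 !inE (negPf bB) subUset !sub1set (negPf bB) !andbF /=.
  by rewrite leq_add2l.
apply: subset_leq_card; rewrite subUset sub andbT sub1set !inE abE /=.
rewrite subUset !sub1set !inE aB eqxx orbT andbT.
by apply/set0Pn; exists b; rewrite !inE eqxx bS orbT.
Qed.

End GrownTrees.

(** The new leaf [y] has [x] as its only neighbour: a cycle through [y] would have [x] on both sides
    of [y], and a cycle avoiding [y] already lies in the smaller tree. *)
Lemma grown_tree (G : sgraph) (A : {set G}) E : grown A E -> @is_tree G (A, E).
Proof.
elim=> [x|{}A {}E x y gAE IH xA yA].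
  apply/andP; split.
    apply/andP; split; first by apply/set0Pn; exists x; rewrite inE.
    by apply/forall_inP => a /set1P->; apply/forall_inP => b /set1P->.
  apply/acyclicP => -[|a [|b c]] //= _ /andP[/andP[]].
  by rewrite /sub_adj /= inE.
have Ey z : [set z; y] \in [set x; y] |: E -> z = x.
  rewrite in_setU1 => /orP[/eqP/setP eq|/(grown_edge gAE)/andP[_]].
    have := eq z; have := eq x; have:= eq y; rewrite !inE !eqxx !orbT /=.
    have xy : x != y by apply: contraNneq yA => <-.
    by rewrite (negPf xy) orbF => _ /eqP.
  by rewrite subUset !sub1set (negPf yA) andbF.
have sym B : symmetric (@sub_adj G B) by move=> a b; rewrite /sub_adj setUC.
case/andP: IH => /andP[_ /forall_inP con] acy; apply/andP; split.
  apply/andP; split; first by apply/set0Pn; exists y; rewrite !inE eqxx.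
  have xc z : z \in y |: A -> connect (@sub_adj G (y |: A, [set x; y] |: E)) x z.
    rewrite !inE => /orP[/eqP->|zA]; first by apply: connect1; rewrite /sub_adj /= !inE eqxx.
    have /forall_inP/(_ z zA) := con x xA; apply: connect_sub => a b ab.
    by apply: connect1; move: ab; rewrite /sub_adj /= !inE => ->; rewrite orbT.
  apply/forall_inP => a aA; apply/forall_inP => b bA.
  by apply: connect_trans (xc b bA); rewrite sym_connect_sym ?xc.
apply/acyclicP => c c2 cyc.
have [yc|yc] := boolP (y \in c).
  have [i c' Ec] := rot_to yc.
  have : ucycle (@sub_adj G (y |: A, [set x; y] |: E)) (y :: c').
    by rewrite -Ec /ucycle rot_cycle rot_uniq.
  have : 2 < size (y :: c') by rewrite -Ec size_rot.
  case: c' {Ec} => [|a c'] //= sz; rewrite /ucycle /= => /andP[].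
  rewrite rcons_path => /and3P[ya _ la] /and3P[_ + _].
  have ax : a = x by apply: Ey; rewrite setUC.
  have lx : last a c' = x by apply: Ey.
  case/lastP: c' sz {la} lx => [|c' z] // _; rewrite last_rcons ax => ->.
  by rewrite mem_rcons inE eqxx.
move/acyclicP: acy => /(_ c c2); apply; case/andP: cyc => cyc uc; apply/andP; split=> //.
apply: (sub_in_cycle (P := [pred z | z \in c]) _ _ cyc); last by apply/allP.
move=> a b ac bc; rewrite /sub_adj /= in_setU1 => /orP[/eqP/setP/(_ y)|//].
rewrite !inE eqxx orbT => /orP[] /eqP yy; [by rewrite yy ac in yc|by rewrite yy bc in yc].
Qed.

(** * Packings of spanning trees in complete graphs with few edges deleted *)

(** Serves to read off colours: for an edge [e] with exactly one end in the list [s],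
    [find (mem e) s] is the position of that end. *)
Lemma find_unique (T : eqType) (x0 : T) (s : seq T) (p : pred T) i :
  uniq s -> i < size s -> p (nth x0 s i) ->
  {in s, forall x, p x -> x = nth x0 s i} -> find p s = i.
Proof.
move=> us ls pi pu; rewrite -[RHS](index_uniq x0 ls us).
apply: eq_in_find => x xs; apply/idP/eqP => [/pu|->//]; exact.
Qed.

Section Colorings.
Variable V : finType.
Implicit Types (A B X : {set V}) (M T E : {set {set V}}).

Definition pairs A := [set e : {set V} | (e \subset A) && (#|e| == 2)].

Lemma set2_injr (x y z : V) : [set x; y] = [set x; z] -> y = z.
Proof.
move=> E; have: y \in [set x; z] by rewrite -E !inE eqxx orbT.
rewrite !inE => /orP[/eqP yx|/eqP//].
have: z \in [set x; y] by rewrite E !inE eqxx orbT.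
by rewrite yx !inE orbb => /eqP.
Qed.

Lemma pairs_rem A e x : e \in pairs A -> x \in e ->
  exists y, [/\ x != y, y \in A & e = [set x; y]].
Proof.
rewrite inE => /andP[eA /cards2P[a [b [ab E]]]].
move: eA; rewrite E subUset !sub1set !inE => /andP[aA bA] /orP[]/eqP->.
  by exists b.
by exists a; rewrite eq_sym setUC.
Qed.

Lemma set2_pairs A x y : x \in A -> y \in A -> x != y -> [set x; y] \in pairs A.
Proof. by move=> xA yA xy; rewrite inE subUset !sub1set xA yA cards2 xy. Qed.

Lemma pairsS A B : A \subset B -> pairs A \subset pairs B.
Proof.
by move=> AB; apply/subsetP => e; rewrite !inE => /andP[/subset_trans->].
Qed.

(** Serves to find isolated vertices: fewer than half as many edges as vertices cannot cover them
    all. *)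
Lemma card_cover_pairs A M : M \subset pairs A -> #|cover M| <= #|M|.*2.
Proof.
move=> /subsetP MA; rewrite -muln2 -sum_nat_const.
apply: leq_trans (leq_card_cover M) _; apply: leq_sum => e /MA.
by rewrite inE => /andP[_ /eqP->].
Qed.

Lemma card_star X x : #|[set [set x; y] | y in X]| = #|X|.
Proof. by rewrite card_imset // => y z /set2_injr. Qed.

Lemma subset_between X A k : X \subset A -> #|X| <= k <= #|A| ->
  exists B, [/\ X \subset B, B \subset A & #|B| = k].
Proof.
move=> XA /andP[]; elim: k => [|k IH] Xk kA.
  by exists X; split=> //; apply/eqP; rewrite -leqn0.
move: Xk; rewrite leq_eqVlt => /orP[/eqP Xk|Xk]; first by exists X.
have [B [XB BA Bk]] := IH Xk (ltnW kA).
have /subsetPn[y yA yB] : ~~ (A \subset B).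
  by apply/negP => /subset_leq_card; lia.
exists (y |: B); rewrite subUset sub1set yA BA cardsU1 yB Bk; split=> //.
exact: subset_trans XB (subsetUr _ _).
Qed.

(* [c] packs the spanning trees: colour class [i < q] contains one of them, so
   they are edge-disjoint, and the forbidden edges get other colours. *)
Definition tree_coloring A M q (c : {set V} -> nat) :=
  {in M, forall e, q <= c e} /\
  forall i, i < q -> exists2 T, grown A T & {in T, forall e, c e = i}.

(* Induction: remove a vertex [u] of positive degree in [M], with neighbours [N],
   and a vertex [v] isolated in [M]; [x0] is a neighbour of [u].  In the rest
   [R], forbid also the star [E1] from [y], isolated in what remains of [M], to
   [W = N :\ x0].  Each of the [q] trees of [R] gets [u] and [v] as leaves; the
   last tree is the double star joining [v] to [u] and [Q], and [u] to [P],
   completed by [E1]. *)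
Lemma odd_tree_coloring q A M : #|A| = q.*2.+1 -> M \subset pairs A -> #|M| <= q ->
  exists c, tree_coloring A M q c.
Proof.
elim: q A M => [|q IH] A M cA; first by exists (fun=> 0).
(* If [M] is empty, an arbitrary pair is forbidden instead, so that a vertex [u] of positive degree
   exists. *)
wlog /set0Pn[e eM] : M / M != set0.
  move=> H MA Mq; have [M0|] := eqVneq M set0; last by move/H; apply.
  have /card_geqP[s [us s2 sA]] : 2 <= #|A| by rewrite cA.
  case: s us s2 sA => [|a [|b []]] // + _ sA; rewrite /= inE andbT => ab.
  have abA : [set a; b] \in pairs A by apply: set2_pairs => //; apply: sA; rewrite !inE eqxx ?orbT.
  have [|||c [_ cT]] := H [set [set a; b]].
  - by apply/set0Pn; exists [set a; b]; rewrite inE.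
  - by rewrite sub1set.
  - by rewrite cards1.
  by exists c; split=> // e; rewrite M0 inE.
move=> MA Mq; have [u ue] : exists u, u \in e.
  by apply/set0Pn; rewrite -card_gt0; move/(subsetP MA): eM; rewrite inE => /andP[_ /eqP->].
have [x0 [ux0 _ Ee]] := pairs_rem (subsetP MA _ eM) ue.
pose N := [set x | [set u; x] \in M]; have x0N : x0 \in N by rewrite inE -Ee.
have /subsetPn[v vA vM] : ~~ (A \subset cover M).
  by apply/negP => /subset_leq_card; have := card_cover_pairs MA; move: cA Mq; clear; lia.
have vNM f : f \in M -> v \notin f.
  by move=> fM; apply: contra vM => vf; apply/bigcupP; exists f.
have uA : u \in A by move: (subsetP MA _ eM); rewrite inE => /andP[/subsetP eA _]; apply: eA.
have uv : u != v by apply: contraTneq ue => ->; apply: vNM.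
pose R := A :\ u :\ v.
have cR : #|R| = q.*2.+1.
  by move: cA; rewrite (cardsD1 u) uA (cardsD1 v) !inE (eq_sym v) uv vA /R /=; lia.
have uR : u \notin R by rewrite !inE eqxx andbF.
have vR : v \notin R by rewrite !inE eqxx.
have NR : N \subset R.
  apply/subsetP => x; rewrite inE => uxM; have := vNM _ uxM.
  have [z [uz zA /set2_injr ->]] := pairs_rem (subsetP MA _ uxM) (set21 u x).
  by rewrite !inE negb_or zA eq_sym andbT => /andP[_ vz]; rewrite eq_sym vz eq_sym.
pose M1 := [set e in M | u \notin e].
have cM1 : #|M1| + #|N| <= #|M|.
  rewrite -(card_star N u) -[X in _ <= X](cardsID M1).
  apply: leq_add; first by rewrite (setIidPr _) //; apply/subsetP => f; rewrite !inE => /andP[].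
  apply: subset_leq_card; apply/subsetP => f /imsetP[x]; rewrite !inE => xM ->.
  by rewrite xM !inE eqxx.
have M1R : M1 \subset pairs R.
  apply/subsetP => f; rewrite inE => /andP[fM uf]; have := subsetP MA _ fM.
  rewrite !inE => /andP[fA ->]; rewrite andbT; apply/subsetP => x xf.
  rewrite !inE (subsetP fA) // andbT; apply/andP; split.
    by apply: contraTneq xf => ->; apply: vNM.
  by apply: contraTneq xf => ->.
pose W := N :\ x0.
have cW : #|N| = #|W|.+1 by rewrite (cardsD1 x0) x0N.
have WR : W \subset R by apply: subset_trans NR; apply: subD1set.
have cRW : #|R :\: W| + #|W| = q.*2.+1 by rewrite addnC -cR -(cardsID W R) (setIidPr WR).
(* [M1] and [W] together have at most [q] elements, so [M1] covers at most [2q - 2|W|] vertices,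
   fewer than the [2q + 1 - |W|] of [R :\: W]. *)
have /subsetPn[y yRW yM1] : ~~ (R :\: W \subset cover M1).
  by apply/negP => /subset_leq_card; have := card_cover_pairs M1R; move: cRW cM1 cW Mq; clear; lia.
have [yW yR] : y \notin W /\ y \in R by move: yRW; rewrite inE => /andP[].
pose E1 := [set [set y; w] | w in W].
have [||c [cM cT]] := IH R (M1 :|: E1) cR.
- rewrite subUset M1R; apply/subsetP => f /imsetP[w wW ->].
  by apply: set2_pairs (yR) (subsetP WR _ wW) _; apply: contraNneq yW => ->.
- by apply: leq_trans (leq_card_setU _ _) _; rewrite card_star; move: cM1 cW Mq; clear; lia.
have [||Q [x0Q QRW cQ]] := @subset_between [set x0] (R :\: W) q.+1.
- by rewrite sub1set !inE eqxx; move: (subsetP NR _ x0N); rewrite !inE.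
- by rewrite cards1; move: cRW cM1 cW Mq; clear; lia.
have x0Q' : x0 \in Q by rewrite -sub1set.
have QR : Q \subset R := subset_trans QRW (subsetDl _ _).
pose P := (R :\: W) :\: Q.
(* Tree [i] receives [u] at the [i]-th vertex of [su] and [v] at the [i]-th of [sv]; [su] avoids [N]
   because [Q] meets [N] only in [x0]. *)
pose su := enum (Q :\ x0); pose sv := enum (R :\: Q).
have zsu : size su = q by rewrite -cardE; have := cardsD1 x0 Q; rewrite x0Q' cQ; clear; lia.
have zsv : size sv = q.
  by rewrite -cardE; have := cardsID Q R; rewrite (setIidPr QR) cQ cR; clear; lia.
have suP x : x \in su = (x != x0) && (x \in Q) by rewrite mem_enum !inE.
have svP x : x \in sv = (x \notin Q) && (x \in R) by rewrite mem_enum inE.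
(* An edge at [v] or [u] whose other end is not in the list gets the default of [find], the length
   [q] of the list, which is the colour of the last tree. *)
pose c' (e : {set V}) := if e \in M then q.+1 else
  if v \in e then find (mem e) sv else if u \in e then find (mem e) su else
  if e \in E1 then q else c e.
exists c'; split=> [f fM|i]; first by rewrite /c' fM.
have vE (f : {set V}) : v \in f -> f \notin M by apply: contraL; apply: vNM.
have uE x : x \notin N -> [set u; x] \notin M by rewrite inE.
have RW x : x \in Q -> x \notin W by move=> /(subsetP QRW); rewrite inE => /andP[].
have neR x z : x \in R -> z \notin R -> x == z = false by move=> xR; apply: contraNF => /eqP<-.
have suR x : x \in su -> x \in R by rewrite suP => /andP[_]; apply: (subsetP QR).
have svR x : x \in sv -> x \in R by rewrite svP => /andP[].
have AE : A = v |: (u |: R).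
  apply/setP => x; rewrite !inE; case: eqVneq => [->|_] /=; first by rewrite vA.
  by case: eqVneq => [->|].
have RE : R = Q :|: P :|: W.
  apply/setP => x; rewrite !in_setU [x \in P]in_setD [x \in _ :\: W]in_setD.
  case xQ: (x \in Q); first by rewrite (subsetP QR).
  by case xW: (x \in W); [rewrite (subsetP WR)|rewrite orbF].
have PW x : x \in P -> x \notin W by rewrite in_setD [x \in _ :\: W]in_setD => /and3P[].
rewrite ltnS leq_eqVlt => /orP[/eqP->|iq].
  have c1 : {in (u |: Q), forall x, (v \in [set v]) && (x \notin [set v])}.
    move=> x; rewrite !inE eqxx.
    by move=> /orP[/eqP->//|/(subsetP QR)/neR->].
  have g1 := grown_leaves (f := fun=> v) (Grown1 v) c1.
  have c2 : {in P, forall x, (u \in [set v] :|: (u |: Q)) && (x \notin [set v] :|: (u |: Q))}.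
    move=> x; rewrite in_setD !in_setU !in_set1.
    case/andP => /negPf xQ /setDP[xR _].
    by rewrite eqxx orbT xQ !neR.
  have g2 := grown_leaves (f := fun=> u) g1 c2.
  have c3 : {in W, forall x, (y \in [set v] :|: (u |: Q) :|: P) && (x \notin [set v] :|: (u |: Q) :|: P)}.
    move=> x xW; have xR := subsetP WR _ xW.
    move: yR; rewrite RE !in_setU (negPf yW) orbF !in_set1 !(neR x) //.
    have /negPf-> : x \notin Q by apply: contraL xW; apply: RW.
    have /negPf-> : x \notin P by apply: contraL xW; apply: PW.
    by case/orP=> ->; rewrite ?orbT.
  have g3 := grown_leaves (f := fun=> y) g2 c3.
  eexists; first by rewrite AE RE !setUA; move: g3; rewrite !setUA; apply.
  move=> f; rewrite !in_setU in_set0 /= => /orP[/orP[]|] /imsetP[x].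
  - move=> xQ ->; rewrite /c' (negPf (vE _ (set21 v x))) set21 hasNfind ?zsv //.
    apply/hasPn => z; rewrite svP => /andP[zQ zR]; rewrite !inE neR //=.
    by apply: contraNneq zQ => zx; move: xQ; rewrite -zx !inE neR.
  - move=> xP ->; have [xR xW xQ] : [/\ x \in R, x \notin W & x \notin Q].
      by move: xP; rewrite !in_setD => /and3P[].
    (* [N] consists of [W] and [x0], and [P] avoids both, so [u] may be joined to [P]. *)
    have xN : x \notin N.
      by apply: contra xW => xN; rewrite in_setD1 xN andbT; apply: contraNneq xQ => ->.
    rewrite /c' (negPf (uE _ xN)) !inE !(eq_sym v) (negPf uv) neR //= eqxx /=.
    rewrite hasNfind ?zsu //; apply/hasPn => z; rewrite suP => /andP[_ zQ].
    have zR := subsetP QR _ zQ; rewrite inE /= !inE negb_or (neR _ _ zR uR) /=.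
    by apply: contraNneq xQ => <-.
  - move=> xW ->; have xR := subsetP WR _ xW.
    have fE : [set y; x] \in E1 by apply: imset_f.
    have uf : u \notin [set y; x] by rewrite !inE !(eq_sym u) !neR.
    have /negPf fM : [set y; x] \notin M.
      apply: contra yM1 => fM; apply/bigcupP; exists [set y; x]; last exact: set21.
      by rewrite inE fM.
    by rewrite /c' fM (negPf uf) fE !inE !(eq_sym v) !neR.
pose a := nth x0 su i; pose b := nth x0 sv i.
have aU : a \in su by rewrite mem_nth ?zsu.
have bV : b \in sv by rewrite mem_nth ?zsv.
have [T gT Tc] := cT i iq.
exists ([set b; v] |: ([set a; u] |: T)).
  rewrite AE; apply: GrownLeaf; [apply: GrownLeaf => // | | ].
  - exact: suR.
  - by rewrite in_setU1 svR ?orbT.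
  - by rewrite in_setU1 negb_or eq_sym uv.
move=> f; rewrite !in_setU1 => /or3P[/eqP->|/eqP->|fT].
- rewrite /c' (negPf (vE _ (set22 b v))) set22.
  apply: (find_unique (x0 := x0)); rewrite ?enum_uniq ?zsv //=; first exact: set21.
  by move=> z zs; rewrite !inE (neR z v (svR _ zs) vR) orbF => /eqP.
- have aN : a \notin N.
    move: aU; rewrite suP => /andP[ax /RW]; rewrite !inE negb_and.
    by rewrite ax.
  rewrite /c' setUC (negPf (uE _ aN)) !inE !(eq_sym v) (negPf uv) (neR a v (suR _ aU) vR) /= eqxx /=.
  apply: (find_unique (x0 := x0)); rewrite ?enum_uniq ?zsu //=; first exact: set22.
  by move=> z zs; rewrite !inE (neR z u (suR _ zs) uR) /= => /eqP.
- have /andP[_ /subsetP fR] := grown_edge gT fT.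
  have vf : v \notin f by apply: contra vR; apply: fR.
  have uf : u \notin f by apply: contra uR; apply: fR.
  have : f \notin M1 :|: E1.
    by apply/negP => /cM; rewrite Tc // leqNgt iq.
  rewrite /c' (negPf vf) (negPf uf) !inE uf andbT negb_or => /andP[/negPf-> /negPf->].
  exact: Tc.
Qed.

(* Remove a vertex [v] and forbid a star [M] from [z] to [q] vertices [X] in the
   rest: [v] becomes a leaf of the other trees through [X], and the last tree
   is the star of [v] away from [X] together with [M]. *)
Lemma even_tree_coloring q A : #|A| = q.+1.*2 ->
  exists c, tree_coloring A set0 q.+1 c.
Proof.
move=> cA; have [v vA] : exists v, v \in A by apply/card_gt0P; rewrite cA.
pose R := A :\ v; have AE : A = v |: R by rewrite setD1K.
have cR : #|R| = q.*2.+1 by move: cA; rewrite AE cardsU1 !inE eqxx; lia.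
have {AE} [vR AE] : v \notin R /\ A = v |: R by rewrite {1}/R !inE eqxx.
clearbody R.
have [z zR] : exists z, z \in R by apply/card_gt0P; rewrite cR.
have [||X [_ XR cX]] := @subset_between set0 (R :\ z) q; first exact: sub0set.
  by move: cR; rewrite cards0 (cardsD1 z) zR; lia.
have zX : z \notin X by apply/negP => /(subsetP XR); rewrite !inE eqxx.
have {}XR : X \subset R by apply: subset_trans XR (subD1set _ _).
pose M := [set [set z; x] | x in X].
have [||c [cM cT]] := odd_tree_coloring (M := M) cR; last 1 first.
- pose s := enum X; have zs : size s = q by rewrite -cardE.
  (* Edges from [v] to [R :\: X] get the default [q], the length of [s], hence the colour of the
     last tree. *)
  pose c' (e : {set V}) := if v \in e then find (mem e) s else
    if e \in M then q else c e.
  exists c'; split=> [e|i]; first by rewrite inE.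
  have neR x : x \in R -> x == v = false by move=> xR; apply: contraNF vR => /eqP<-.
  have sX x : x \in s = (x \in X) by rewrite mem_enum.
  rewrite ltnS leq_eqVlt => /orP[/eqP->|iq].
    have c1 : {in R :\: X, forall x, (v \in [set v]) && (x \notin [set v])}.
      move=> x /setDP[xR _].
      by rewrite !inE eqxx neR.
    have g1 := grown_leaves (f := fun=> v) (Grown1 v) c1.
    have c2 : {in X, forall x, (z \in [set v] :|: R :\: X) && (x \notin [set v] :|: R :\: X)}.
      move=> x xX; have xR := subsetP XR _ xX.
      by rewrite !inE zR zX xX (neR x) ?orbT.
    have g2 := grown_leaves (f := fun=> z) g1 c2.
    have RX : X :|: R :\: X = R by rewrite -{1}(setIidPr XR) setID.
    move: g2; rewrite -setUA (setUC _ X) RX -AE => g2.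
    eexists; first exact g2.
    move=> f; rewrite !in_setU in_set0 /= => /orP[] /imsetP[x].
      move=> /setDP[xR xX] ->; rewrite /c' set21 hasNfind //.
      apply/hasPn => y; rewrite sX !inE => yX; rewrite neR ?(subsetP XR) //=.
      by apply: contraNneq xX => <-.
    move=> xX ->; have fM : [set z; x] \in M by apply: imset_f.
    by rewrite /c' fM in_set2 !(eq_sym v) (neR z) // (neR x) //; apply: (subsetP XR).
  have [T gT Tc] := cT i iq; pose b := nth v s i.
  have bX : b \in X by rewrite -sX mem_nth ?zs.
  exists ([set b; v] |: T); first by rewrite AE; exact: GrownLeaf gT (subsetP XR _ bX) vR.
  move=> f; rewrite in_setU1 => /orP[/eqP->|fT].
    rewrite /c' set22; apply: (find_unique (x0 := v)); rewrite ?enum_uniq ?zs //=.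
      exact: set21.
    by move=> x; rewrite sX !inE => xX; rewrite (neR x) ?(subsetP XR) // orbF => /eqP.
  have /andP[_ /subsetP fR] := grown_edge gT fT.
  have /negPf vf : v \notin f by apply: contra vR; apply: fR.
  rewrite /c' vf; case: ifP => [/cM|_]; last exact: Tc.
  by rewrite Tc // leqNgt iq.
- apply/subsetP => f /imsetP[x xX ->]; apply: set2_pairs => //.
    exact: (subsetP XR).
  by apply: contraNneq zX => ->.
- by rewrite card_star cX.
Qed.

Lemma tree_coloring_exists A M : 0 < #|A| -> M \subset pairs A ->
  #|M| <= (if odd #|A| then #|A|./2 else 0) ->
  exists c, tree_coloring A M #|A|./2 c.
Proof.
move=> A0 MA cM; case: ifP cM => [o|e] cM.
  by apply: odd_tree_coloring; lia.
have -> : M = set0 by apply/eqP; rewrite -cards_eq0 -leqn0.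
have [q Aq] : exists q, #|A| = q.+1.*2 by exists #|A|./2.-1; lia.
by rewrite Aq doubleK; apply: even_tree_coloring.
Qed.

End Colorings.

(** * Lower bound on [kappa] *)

(** Double counting: each element of [U] lies in at most one [f i]. *)
Lemma sum_card_disjoint (I X : finType) (P : pred I) (f : I -> {set X}) (U : {set X}) :
  (forall i, P i -> f i \subset U) ->
  (forall i j, P i -> P j -> i != j -> [disjoint f i & f j]) ->
  \sum_(i | P i) #|f i| <= #|U|.
Proof.
move=> fU fd.
have -> : \sum_(i | P i) #|f i| = \sum_(i | P i) \sum_(x in U) (x \in f i).
  apply: eq_bigr => i /fU fiU; rewrite -big_mkcondr sum1_card.
  apply: eq_card => x; rewrite [RHS]unfold_in /= andb_idl //; exact: (subsetP fiU).
rewrite exchange_big -sum1_card /=; apply: leq_sum => x _.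
rewrite -big_mkcondr sum1_card; apply/card_le1_eqP => i j.
rewrite !unfold_in /= => /andP[Pi xi] /andP[Pj xj]; apply/eqP; apply: contraT => ij.
by have := disjointFr (fd _ _ Pj Pi ij) (xj : x \in f j); rewrite (xi : x \in f i).
Qed.

Section LowerBound.
Variable G : sgraph.
Implicit Types (S A : {set G}) (E : {set {set G}}) (F : {set presubgraph G}).

Definition nonedges := pairs [set: G] :\: edges G.

Lemma edges_adj (x y : G) : ([set x; y] \in edges G) = adj x y.
Proof.
apply/imsetP/idP => [[[a b]]|xy]; last by exists (x, y); rewrite ?inE.
rewrite inE /= => ab E.
have : x \in [set a; b] by rewrite -E set21.
rewrite !inE => /orP[]/eqP xE; subst x.
  by rewrite (set2_injr E).
by rewrite [RHS]setUC in E; rewrite (set2_injr E) adj_sym.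
Qed.

Lemma edges_pairs : edges G \subset pairs [set: G].
Proof.
apply/subsetP => e /imsetP[[a b]]; rewrite inE /= => ab ->; apply: set2_pairs; rewrite ?inE //.
by apply: contraTneq ab => ->; rewrite adj_irrefl.
Qed.

Lemma nonedges_adj (x y : G) : x != y -> ([set x; y] \in nonedges) = ~~ adj x y.
Proof. by move=> xy; rewrite inE edges_adj set2_pairs ?inE ?andbT. Qed.

Lemma grown_connecting_tree S A E :
  grown A E -> E \subset edges G -> S \subset A -> connecting_tree S (A, E).
Proof.
move=> gAE EG SA; apply/and3P; split=> //; last exact: grown_tree.
by rewrite /is_subgraph EG; apply/forall_inP => e /(grown_edge gAE)/andP[].
Qed.

Lemma connecting_tree_edges_meeting S T x0 : connecting_tree S T -> x0 \in T.1 ->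
  #|S :\ x0| <= #|[set e in T.2 | e :&: S != set0]|.
Proof.
case/and3P=> /andP[_ /forall_inP sub] /andP[con _] ST x0T.
exact: connected_edges_meeting con x0T ST sub.
Qed.

(** Passing from a family to a set needs injectivity: as [S] has two vertices, each tree has an
    edge, so edge-disjoint trees differ. *)
Lemma kappa_ge (I : finType) (T : I -> presubgraph G) S : 1 < #|S| ->
  (forall i, connecting_tree S (T i)) ->
  (forall i j, i != j -> internally_disjoint S (T i) (T j)) -> #|I| <= kappa S.
Proof.
move=> S1 cT dT; have injT : injective T.
  move=> i j ij; apply/eqP; apply: contraT => /dT /andP[+ _].
  rewrite -ij setIid => /eqP T0.
  have [x xS] : exists x, x \in S by apply/card_gt0P; apply: ltnW.
  have xT : x \in (T i).1 by case/and3P: (cT i) => _ _ /subsetP; apply.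
  have := connecting_tree_edges_meeting (cT i) xT.
  rewrite T0 (_ : [set _ in _ | _] = set0) ?cards0; last by apply/setP => e; rewrite !inE.
  by rewrite leqNgt => /negP[]; move: S1; rewrite (cardsD1 x) xS.
rewrite -(card_imset _ injT) /kappa -[X in X <= _]/(#|pred_of_set (T @: I)|).
apply: (leq_bigmax_cond (F := fun F : {set presubgraph G} => #|F|)).
apply/andP; split.
  by apply/forall_inP => _ /imsetP[i _ ->].
apply/forall_inP => _ /imsetP[i _ ->]; apply/forall_inP => _ /imsetP[j _ ->].
by apply/implyP => ij; apply: dT; apply: contraNneq ij => ->.
Qed.

Lemma kappa_packing S : exists2 F, tree_packing S F & kappa S = #|F|.
Proof.
have P0 : tree_packing S set0.
  by apply/andP; split; apply/forall_inP => T; rewrite inE.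
rewrite /kappa (bigmax_eq_arg _ P0); case: arg_maxnP => // F PF _.
by exists F.
Qed.

Lemma kappa_lower S : 1 < #|S| ->
  #|nonedges| <= (if odd #|S| then #|S|./2 else 0) -> #|~: S| + #|S|./2 <= kappa S.
Proof.
set q := #|S|./2 => S1 NEq; have NE2 : #|nonedges|.*2 < #|S|.
  by move: NEq S1; rewrite /q; case: ifP; lia.
(* [U] holds the possible targets of completing edges, and [D s] the centres [w] whose star misses
   [s]. *)
pose U := S :\: cover nonedges.
pose D (s : G) := [set w in ~: S | ~~ adj w s].
have DP w s : w \in D s = (w \notin S) && ~~ adj w s by rewrite !inE.
have DN w s : s \in S -> w \in D s -> [set w; s] \in nonedges.
  move=> sS; rewrite DP => /andP[wS ws]; rewrite nonedges_adj //.
  by apply: contraNneq wS => ->.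
have UP x e : x \in U -> e \in nonedges -> x \notin e.
  by case/setDP=> _ xN eN; apply: contra xN => xe; apply/bigcupP; exists e.
have SU s w x : s \in S -> w \in D s -> x \in U -> x != s.
  by move=> sS wD xU; have := UP _ _ xU (DN _ _ sS wD); rewrite !inE negb_or => /andP[].
(* Distinct centres missing [s] need distinct targets. Apart from the star from [s] to [D s], the
   missing edges cover at most [2 (|nonedges| - |D s|)] vertices, and [2 |nonedges| < |S|], so
   enough of [S] stays uncovered. *)
have cD s : s \in S -> #|D s| <= #|U|.
  move=> sS; pose st := [set [set s; w] | w in D s].
  have stN : st \subset nonedges.
    by apply/subsetP => _ /imsetP[w wD ->]; rewrite setUC; apply: DN.
  have cst : #|nonedges :\: st| + #|D s| = #|nonedges|.
    by rewrite -(card_star (D s) s) addnC -[RHS](cardsID st) (setIidPr stN).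
  have cc : #|cover (nonedges :\: st)| <= #|nonedges :\: st|.*2.
    apply: (@card_cover_pairs _ setT); apply: subset_trans (subsetDl _ _) _.
    exact: subsetDl.
  have : #|S :&: cover nonedges| <= (#|cover (nonedges :\: st)|).+1.
    rewrite -[X in _ <= X]add1n -(cards1 s); apply: leq_trans (leq_card_setU _ _).
    apply: subset_leq_card; apply/subsetP => x /setIP[xS /bigcupP[e eN xe]].
    rewrite in_setU1; case: eqVneq => //= xs; apply/bigcupP; exists e => //.
    rewrite inE eN andbT; apply: contraTN xe => /imsetP[w wD ->].
    rewrite !inE (negPf xs) /=; apply: contraTneq wD => <-.
    by rewrite DP xS.
  move: (cardsID (cover nonedges) S); rewrite -/U; move: cst cc NE2; clear; lia.
(* The rank of [w] in [D s] selects its target in [U]; by [cD] the default [s] is never reached when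
   [w] is in [D s]. *)
pose g w s := nth s (enum U) (index w (enum (D s))).
have iU w s : s \in S -> w \in D s -> index w (enum (D s)) < size (enum U).
  move=> sS wD; rewrite -cardE; apply: leq_trans (cD s sS).
  by rewrite [X in _ < X]cardE index_mem mem_enum.
have gU w s : s \in S -> w \in D s -> g w s \in U.
  by move=> sS wD; rewrite -mem_enum; apply: mem_nth; apply: iU.
have gI w w' s : s \in S -> w \in D s -> w' \in D s -> g w s = g w' s -> w = w'.
  move=> sS wD wD' /eqP; rewrite nth_uniq ?iU ?enum_uniq // => /eqP ii.
  by rewrite -(nth_index w (s := enum (D s)) (x := w)) ?mem_enum // ii nth_index ?mem_enum.
pose Dp := [set p : G * G | (p.2 \in S) && (p.1 \in D p.2)].
(* The spanning trees of [S] must avoid the edges missing inside [S] and the completing edges of the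
   stars. *)
pose M := [set e in nonedges | e \subset S] :|: [set [set g p.1 p.2; p.2] | p in Dp].
have US x : x \in U -> x \in S by case/setDP.
have MS : M \subset pairs S.
  rewrite subUset; apply/andP; split; apply/subsetP => e.
    by rewrite inE => /andP[/setDP[+ _] eS]; rewrite !inE eS => /andP[].
  case/imsetP => [[w s]]; rewrite inE /= => /andP[sS wD] ->.
  by apply: set2_pairs => //; [apply: US; apply: gU|apply: SU sS wD (gU _ _ sS wD)].
(* Each completing edge is charged to the missing edge between [w] and [s] that it replaces, which
   is not contained in [S]. *)
have cM : #|M| <= #|nonedges|.
  apply: leq_trans (leq_card_setU _ _) _.
  rewrite -[X in _ <= X](cardsID [set e : {set G} | e \subset S]); apply: leq_add.
    by apply: subset_leq_card; apply/subsetP => e; rewrite !inE.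
  apply: leq_trans (leq_imset_card _ _) _.
  rewrite -(card_in_imset (f := fun p : G * G => [set p.1; p.2]) (D := Dp)).
    apply: subset_leq_card; apply/subsetP => _ /imsetP[[w s] + ->].
    rewrite inE /= => /andP[sS wD]; rewrite in_setD DN // andbT inE subUset sub1set.
    by move: wD; rewrite DP => /andP[/negPf->].
  move=> [w s] [w' s']; rewrite !inE /= => /and3P[sS wS _] /and3P[sS' wS' _] ee.
  have : w \in [set w'; s'] by rewrite -ee set21.
  rewrite !inE => /orP[/eqP ww|/eqP ww]; last by rewrite ww sS' in wS.
  by move: ee; rewrite ww => /set2_injr->.
have [||c [cM' cT]] := @tree_coloring_exists _ S M _ MS.
- exact: ltnW.
- exact: leq_trans cM NEq.
have /fin_all_exists[T TP] (i : 'I_q) : exists T, grown S T /\ {in T, forall e, c e = i}.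
  by have [T gT Tc] := cT i (ltn_ord i); exists T.
pose Ew w := set0 :|: [set [set w; s] | s in [set s in S | adj w s]]
   :|: [set [set g w s; s] | s in [set s in S | ~~ adj w s]].
have gw w : w \notin S -> grown (w |: S) (Ew w).
  move=> wS; have c1 : {in [set s in S | adj w s], forall s, (w \in [set w]) && (s \notin [set w])}.
    by move=> s; rewrite !inE eqxx => /andP[sS _]; apply: contraNneq wS => <-.
  have g1 := grown_leaves (f := fun=> w) (Grown1 w) c1.
  have c2 : {in [set s in S | ~~ adj w s], forall s,
      (g w s \in [set w] :|: [set s in S | adj w s]) && (s \notin [set w] :|: [set s in S | adj w s])}.
    move=> s; rewrite inE => /andP[sS ws]; have wD : w \in D s by rewrite DP wS.
    have gS := US _ (gU _ _ sS wD); rewrite !inE sS (negPf ws) orbF gS.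
    have wg : w != g w s by apply: contraNneq wS => ->.
    apply/andP; split; last by apply: contraNneq wS => <-.
    (* The target is incident with no missing edge, so it is adjacent to [w] and already lies in the
       star. *)
    apply/orP; right; apply: contraT; rewrite -nonedges_adj // => /(UP _ _ (gU _ _ sS wD)).
    by rewrite set22.
  have := grown_leaves g1 c2; rewrite (_ : _ :|: _ = w |: S) // -setUA; congr (_ :|: _).
  by apply/setP => s; rewrite !inE -andb_orr orbN andbT.
have wE w e : w \notin S -> e \in Ew w -> (w \in e) ||
    [exists s in S, (w \in D s) && (e == [set g w s; s])].
  move=> wS; rewrite in_setU in_setU in_set0 /= => /orP[]/imsetP[s + ->]; rewrite inE => /andP[sS ws].
    by rewrite set21.
  by apply/orP; right; apply/exists_inP; exists s => //; rewrite DP wS ws eqxx.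
have inl_inr (i : 'I_q) w : w \notin S -> T i :&: Ew w = set0.
  move=> wS; apply/setP => e; rewrite in_set0 in_setI; apply/negP => /andP[eT eW].
  have [gT Tc] := TP i; have /andP[_ eS] := grown_edge gT eT.
  case/orP: (wE _ _ wS eW) => [/(subsetP eS)|/exists_inP[s sS /andP[wD /eqP ee]]]; first by apply/negP.
  have /cM' : e \in M.
    by rewrite in_setU; apply/orP; right; apply/imsetP; exists (w, s); rewrite // inE sS.
  by rewrite Tc // leqNgt ltn_ord.
(* A common edge contains neither centre, so it completes both stars. Its end in [U] is missed by no
   centre, so both stars miss the same [s], and [gI] identifies the centres. *)
have inr_inr w w' : w \notin S -> w' \notin S -> w != w' -> Ew w :&: Ew w' = set0.
  move=> wS wS' ww; apply/setP => e; rewrite in_set0 in_setI; apply/negP => /andP[eW eW'].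
  have /andP[_ eS] := grown_edge (gw _ wS) eW; have /andP[_ eS'] := grown_edge (gw _ wS') eW'.
  case/orP: (wE _ _ wS eW) => [/(subsetP eS')|/exists_inP[s sS /andP[wD /eqP ee]]].
    by rewrite !inE (negPf ww) (negPf wS).
  case/orP: (wE _ _ wS' eW') => [/(subsetP eS)|/exists_inP[s' sS' /andP[wD' /eqP ee']]].
    by rewrite !inE eq_sym (negPf ww) (negPf wS').
  have : s \in [set g w' s'; s'] by rewrite -ee' ee set22.
  rewrite !inE => /orP[/eqP sg|/eqP ss].
    by have := SU _ _ _ sS wD (gU _ _ sS' wD'); rewrite sg eqxx.
  subst s'; move: ee'; rewrite ee setUC [RHS]setUC => /set2_injr /(gI _ _ _ sS wD wD') /eqP.
  by rewrite (negPf ww).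
pose TT (i : 'I_q + {w | w \in ~: S}) : presubgraph G :=
  match i with inl i => (S, T i) | inr w => (sval w |: S, Ew (sval w)) end.
have := @kappa_ge _ TT S S1; rewrite card_sum card_ord card_sig addnC; apply.
- case=> [i|[w]] /=.
    have [gT Tc] := TP i; apply: grown_connecting_tree => //.
    apply/subsetP => e eT; apply: contraT => eG; have /andP[e2 eS] := grown_edge gT eT.
    have /cM' : e \in M by rewrite in_setU !inE eG subsetT e2 eS.
    by rewrite Tc // leqNgt ltn_ord.
  rewrite inE => wS; apply: grown_connecting_tree; [exact: gw| |exact: subsetUr].
  rewrite !subUset sub0set /=; apply/andP; split; apply/subsetP => _ /imsetP[s + ->]; rewrite inE => /andP[sS ws].
    by rewrite edges_adj.
  have wD : w \in D s by rewrite DP wS.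
  have gs := SU _ _ _ sS wD (gU _ _ sS wD).
  rewrite edges_adj; apply: contraT; rewrite -nonedges_adj // => /(UP _ _ (gU _ _ sS wD)).
  by rewrite set21.
- case=> [i|[w wS]] [j|[w' wS']]; rewrite /internally_disjoint /=.
  + move=> ij; rewrite setIid eqxx andbT; apply/eqP/setP => e; rewrite in_set0 in_setI.
    apply/negP => /andP[ei ej]; case/eqP: ij; congr inl; apply: val_inj => /=.
    by rewrite -((TP i).2 e ei) ((TP j).2 e ej).
  + rewrite inE in wS' => _; rewrite inl_inr // eqxx; apply/eqP/setP => x; rewrite !inE.
    by case: (x \in S); rewrite ?orbT.
  + rewrite inE in wS => _; rewrite setIC inl_inr // eqxx; apply/eqP/setP => x.
    by rewrite !inE; case: (x \in S); rewrite ?orbT ?andbF.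
  + move=> ww; have {}ww : w != w'.
      by apply: contraNneq ww => E; apply/eqP; congr inr; apply: val_inj.
    rewrite !inE in wS wS'; rewrite inr_inr // eqxx; apply/eqP/setP => x; rewrite !inE.
    by case: (x \in S); rewrite ?orbT ?orbF //; case: eqVneq => [->|] //=; rewrite (negPf ww).
Qed.

End LowerBound.

(** * Upper bound on [kappa] *)

Lemma bin2_addn m k : 'C(m + k, 2) = 'C(m, 2) + 'C(k, 2) + k * m.
Proof. by elim: m => [|m IH]; rewrite ?muln0 ?addn0 // addSn !binS !bin1 IH; lia. Qed.

Lemma card_pairs (V : finType) (A : {set V}) : #|pairs A| = 'C(#|A|, 2).
Proof. by rewrite -cards_draws. Qed.

Section UpperBound.
Variable G : sgraph.
Implicit Types (S A : {set G}) (E : {set {set G}}) (F : {set presubgraph G}).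

Definition meeting S E := [set e in E | e :&: S != set0].

(** The pairs meeting [S] are all pairs less those inside the complement. *)
Lemma card_meeting S :
  #|meeting S (edges G)| + #|meeting S (nonedges G)| = 'C(#|S|, 2) + #|S| * #|~: S|.
Proof.
have /= := cardsID (pairs (~: S)) (pairs [set: G]).
rewrite (setIidPr (pairsS (subsetT _))) !card_pairs cardsT -(cardsC S).
rewrite [#|S| + _]addnC bin2_addn.
have -> : #|pairs [set: G] :\: pairs (~: S)| =
    #|meeting S (edges G)| + #|meeting S (nonedges G)|.
  rewrite -[LHS](cardsID (edges G)); congr (_ + _); apply: eq_card => e; rewrite !inE.
    have := subsetP (edges_pairs G) e; rewrite !inE /=.
    rewrite setI_eq0 disjoints_subset.
    by case: (e \in edges G) => [/(_ isT)/andP[-> ->]|_]; rewrite ?andbF ?andbT.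
  rewrite setI_eq0 disjoints_subset subsetT.
  by case: (e \in edges G); case: (#|e| == 2); case: (e \subset ~: S); rewrite ?andbF ?andbT.
by rewrite -addnA => /addnI ->.
Qed.

(** [a] counts the trees with vertex set exactly [S], and [b] the others, each of which owns a
    vertex outside [S]. The last inequality counts the pairs meeting [S]. *)
Lemma packing_count S F : 0 < #|S| -> tree_packing S F -> exists a b,
  [/\ #|F| = a + b, b <= #|~: S|, a * #|S|.-1 <= 'C(#|S|, 2) &
      a * #|S|.-1 + b * #|S| + #|meeting S (nonedges G)|
        <= 'C(#|S|, 2) + #|S| * #|~: S|].
Proof.
move=> S0 /andP[/forall_inP cF /forall_inP dF].
have {}dF T T' : T \in F -> T' \in F -> T != T' -> internally_disjoint S T T'.
  by move=> TF T'F; apply/implyP; have /forall_inP := dF T TF; apply.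
have FS T : T \in F -> S \subset T.1 by move/cF => /and3P[].
have FE T : T \in F -> T.2 \subset edges G by move/cF => /and3P[/andP[]].
have disjE T T' : T \in F -> T' \in F -> T != T' -> [disjoint T.2 & T'.2].
  by move=> TF T'F /(dF _ _ TF T'F)/andP[+ _]; rewrite setI_eq0.
pose int := [pred T : presubgraph G | T.1 == S].
exists #|[set T in F | int T]|, #|[set T in F | ~~ int T]|.
have int_card T : T \in F -> int T -> #|S|.-1 <= #|meeting S T.2|.
  move=> TF /eqP TS; have [x xS] : exists x, x \in S by apply/card_gt0P.
  have xT : x \in T.1 by rewrite TS.
  have := connecting_tree_edges_meeting (cF T TF) xT.
  by rewrite [in #|S|.-1](cardsD1 x) xS.
(* Growing from a vertex outside [S], every vertex of [S] brings an edge: one more than when growing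
   from inside. *)
have ext_card T : T \in F -> ~~ int T -> #|S| <= #|meeting S T.2|.
  move=> TF; rewrite /= eqEsubset FS // andbT => /subsetPn[x xT xS].
  have := connecting_tree_edges_meeting (cF T TF) xT.
  by rewrite (_ : S :\ x = S) //; apply/setP => y; rewrite !inE; case: eqVneq => // ->; rewrite (negPf xS).
have sumE (P : pred (presubgraph G)) m :
    (forall T, T \in F -> P T -> m T <= #|meeting S T.2|) ->
    \sum_(T in F | P T) m T <= \sum_(T in F | P T) #|meeting S T.2|.
  by move=> H; apply: leq_sum => T /andP[]; apply: H.
have aE m : \sum_(T in F | int T) m = #|[set T in F | int T]| * m.
  by rewrite sum_nat_const; congr (_ * _); apply: eq_card => T; rewrite !inE.
have bE m : \sum_(T in F | ~~ int T) m = #|[set T in F | ~~ int T]| * m.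
  by rewrite sum_nat_const; congr (_ * _); apply: eq_card => T; rewrite !inE.
split.
- rewrite -(cardsID [set T | int T] F); congr (_ + _); apply: eq_card => T; rewrite !inE //.
  by rewrite andbC.
- rewrite -[X in X <= _]muln1 -bE.
  apply: (@leq_trans (\sum_(T in F | ~~ int T) #|T.1 :\: S|)).
    apply: leq_sum => T /andP[TF]; rewrite /= eqEsubset FS // andbT => nT.
    by rewrite card_gt0 setD_eq0.
  apply: sum_card_disjoint => [T _|T T' /andP[TF _] /andP[TF' _] TT].
    by rewrite setDE subsetIr.
  have /andP[_ /eqP I] := dF _ _ TF TF' TT.
  by rewrite -setI_eq0 -setDIl I setDv.
- rewrite -aE -card_pairs; apply: leq_trans (sumE _ _ int_card) _.
  apply: sum_card_disjoint => [T /andP[TF /eqP TS]|T T' /andP[TF _] /andP[TF' _] TT].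
    apply/subsetP => e; rewrite inE => /andP[eT _].
    have := subsetP (edges_pairs G) _ (subsetP (FE _ TF) _ eT).
    rewrite !inE => /andP[_ ->]; rewrite andbT -TS.
    by case/and3P: (cF _ TF) => /andP[_ /forall_inP sub] _ _; apply: sub.
  apply: disjointW (disjE _ _ TF TF' TT); apply/subsetP => e; rewrite inE => /andP[] //.
- rewrite -card_meeting leq_add2r -aE -bE.
  apply: (@leq_trans (\sum_(T in F) #|meeting S T.2|)).
    rewrite [X in _ <= X](bigID int) /=; apply: leq_add; exact: sumE.
  apply: sum_card_disjoint => [T TF|T T' TF TF' TT].
    by apply/subsetP => e; rewrite !inE => /andP[/(subsetP (FE _ TF)) -> ->].
  apply: disjointW (disjE _ _ TF TF' TT); apply/subsetP => e; rewrite inE => /andP[] //.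
Qed.

(** With [k = |S|] and [q = k./2], the number of pairs in [S] is [q (k - 1)] for even [k] and [q k]
    for odd [k]; either way [a <= q]. Equality forces [a = q] and [b = n - k], and the last count
    then leaves [0], respectively [q], missing edges meeting [S]. *)
Lemma kappa_upper S : 1 < #|S| ->
  kappa S <= #|~: S| + #|S|./2 /\
  (#|~: S| + #|S|./2 <= kappa S ->
   #|meeting S (nonedges G)| <= if odd #|S| then #|S|./2 else 0).
Proof.
move=> S1; have [F PF ->] := kappa_packing S.
have [a [b [-> bS aS ab]]] := packing_count (ltnW S1) PF.
move: S1 bS aS ab; move: #|~: S| #|meeting _ _| #|S| => r m k.
have [q [kE|kE]] : exists q, k = q.*2 \/ k = q.*2.+1 by exists k./2; lia.
  rewrite kE doubleK odd_double.
  have -> : 'C(q.*2, 2) = q * q.*2.-1 by rewrite bin2; nia.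
  move=> q1 br; rewrite leq_pmul2r; last by lia.
  move=> aq H; split; first lia.
  move=> ?; have [Ea Eb] : a = q /\ b = r by lia.
  by move: H; rewrite Ea Eb (mulnC r); lia.
rewrite kE /= odd_double uphalf_double /=.
have -> : 'C(q.*2.+1, 2) = q * q.*2.+1 by rewrite bin2odd /= ?odd_double // doubleK mulnC.
move=> q1 br aq H; have {}aq : a <= q by nia.
split; first lia.
move=> ?; have [Ea Eb] : a = q /\ b = r by lia.
by move: H; rewrite Ea Eb (mulnC r) [q * _.+1]mulnS; lia.
Qed.

End UpperBound.

(** One vertex from each of [j] edges gives at most [j <= k] vertices, which are padded to [k]. *)
Lemma meeting_transversal (G : sgraph) (E : {set {set G}}) j k :
  E \subset pairs [set: G] -> j <= #|E| -> j <= k -> 0 < k <= #|G| ->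
  exists2 S : {set G}, #|S| = k & j <= #|meeting S E|.
Proof.
move=> EG jE jk /andP[k0 kG].
have [|| E' [_ E'E cE']] := @subset_between _ set0 E j; first exact: sub0set.
  by rewrite cards0.
have [x0 _] : exists x0 : G, x0 \in [set: G] by apply/card_gt0P; rewrite cardsT; lia.
pose h (e : {set G}) := odflt x0 [pick x in e].
have hP e : e \in E -> h e \in e.
  move/(subsetP EG); rewrite inE => /andP[_ e2]; rewrite /h; case: pickP => // e0.
  by move: e2; rewrite (_ : e = set0) ?cards0 //; apply/setP => x; rewrite inE e0.
have [|| S [XS _ cS]] := @subset_between _ (h @: E') [set: G] k; first exact: subsetT.
  by rewrite cardsT kG andbT (leq_trans (leq_imset_card _ _)) ?cE'.
exists S => //; rewrite -cE'; apply: subset_leq_card; apply/subsetP => e eE'.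
have eE := subsetP E'E _ eE'; rewrite inE eE; apply/set0Pn; exists (h e).
by rewrite inE hP //= (subsetP XS) ?imset_f.
Qed.

(** * Missing edges up to isomorphism, and the equivalence *)

Lemma isomorphic_del_edges (G : sgraph) n m : #|G| = n ->
  (exists M : {set {set complete n}},
      [/\ M \subset edges (complete n), #|M| <= m & isomorphic G (del_edges M)])
  <-> #|nonedges G| <= m.
Proof.
move=> Gn; split=> [[M [_ Mm [f bf fP]]]|Nm].
  have injf := bij_inj bf; apply: leq_trans Mm.
  (* The isomorphism carries the missing edges of [G] injectively into [M]. *)
  rewrite -(card_imset _ (imset_inj injf)); apply: subset_leq_card.
  apply/subsetP => _ /imsetP[e eN ->].
  have /setDP[/[dup] eP _ _] := eN.
  have [x xe] : exists x, x \in e.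
    by apply/set0Pn; rewrite -card_gt0; move: eP; rewrite inE => /andP[_ /eqP->].
  have [y [xy _ ee]] := pairs_rem eP xe.
  move: eN; rewrite ee nonedges_adj // -fP /= /del_rel /= /complete_rel.
  by rewrite (inj_eq injf) xy negbK imsetU1 imset_set1.
pose f (x : G) : complete n := cast_ord Gn (enum_rank x).
have bf : bijective f.
  exists (fun i => enum_val (cast_ord (esym Gn) i)) => x; rewrite /f.
    by rewrite cast_ordK enum_rankK.
  by rewrite enum_valK cast_ordKV.
have injf := bij_inj bf.
exists [set f @: e | e : {set G} in nonedges G]; split.
- apply/subsetP => _ /imsetP[e /setDP[eP _] ->].
  have [x xe] : exists x, x \in e.
    by apply/set0Pn; rewrite -card_gt0; move: eP; rewrite inE => /andP[_ /eqP->].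
  have [y [xy _ ->]] := pairs_rem eP xe.
  by rewrite imsetU1 imset_set1 edges_adj /= /complete_rel inj_eq.
- exact: leq_trans (leq_imset_card _ _) Nm.
- exists f => // x y; rewrite /= /del_rel /= /complete_rel (inj_eq injf).
  have [->|xy] /= := eqVneq x y; first by rewrite adj_irrefl.
  have -> : [set f x; f y] = f @: [set x; y] by rewrite imsetU1 imset_set1.
  rewrite mem_imset; last exact: imset_inj.
  by rewrite nonedges_adj // negbK.
Qed.

Lemma isomorphic_complete (G : sgraph) n : #|G| = n ->
  isomorphic G (complete n) <-> #|nonedges G| <= 0.
Proof.
move=> Gn; rewrite -(isomorphic_del_edges 0 Gn); split=> [[f bf fP]|[M [_ + [f bf fP]]]].
  exists set0; rewrite sub0set cards0; split=> //; exists f => // x y.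
  by rewrite -fP /= /del_rel inE andbT.
rewrite leqn0 cards_eq0 => /eqP M0; exists f => // x y.
by rewrite -fP /= /del_rel M0 inE andbT.
Qed.

(** The value is [(n - k) + k./2]. If more edges were missing than the bound allows, some [S] of
    size [k] would meet too many of them to attain it, by [kappa_upper]. *)
Lemma gen_connectivity_eq (G : sgraph) k : 1 < k <= #|G| ->
  gen_connectivity G k = #|G| - uphalf k <->
  #|nonedges G| <= (if odd k then k./2 else 0).
Proof.
move=> /andP[k1 kG]; have [[S0 S0k ->] minS] := gen_connectivityP kG.
have cC (S : {set G}) : #|S| = k -> #|~: S| + #|S|./2 = #|G| - uphalf k.
  by move=> Sk; have := cardsC S; rewrite Sk; lia.
have bd (S : {set G}) : #|S| = k -> 1 < #|S| by move->.
have [up _] := kappa_upper (bd _ S0k); rewrite cC // in up.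
split=> [kE|Nk]; last first.
  by apply/eqP; rewrite eqn_leq up -(cC _ S0k) kappa_lower ?S0k.
rewrite leqNgt; apply/negP => lt.
have [||S Sk mS] := meeting_transversal (subsetDl _ _) lt (k := k).
- by case: ifP; lia.
- by rewrite kG ltnW.
have [_ H] := kappa_upper (bd _ Sk); rewrite cC // -kE Sk in H.
by move: (leq_trans mS (H (minS _ Sk))); rewrite ltnn.
Qed.

Theorem theorem4 (G : sgraph) (n k : nat) :
  connected G -> #|G| = n -> 3 <= k <= n ->
  (gen_connectivity G k = n - uphalf k <->
   (~~ odd k -> isomorphic G (complete n)) /\
   (odd k -> exists M : {set {set complete n}},
      [/\ M \subset edges (complete n), 2 * #|M| <= k - 1
        & isomorphic G (del_edges M)])).
Proof.
move=> _ Gn /andP[k3 kn].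
have [|fwd bwd] := @gen_connectivity_eq G k; first by rewrite Gn kn ltnW.
(* For odd [k], the condition [2 * #|M| <= k - 1] says [#|M| <= k./2]. *)
rewrite Gn in fwd bwd; have isoM := isomorphic_del_edges k./2 Gn.
have isoK := isomorphic_complete Gn.
case: (boolP (odd k)) fwd bwd => ok fwd bwd; split.
- move/fwd/isoM.2 => [M [ME Mk iso]]; split=> // _; exists M; split=> //; lia.
- case=> _ /(_ isT) [M [ME Mk iso]]; apply: bwd; apply/isoM.1.
  exists M; split=> //; lia.
- by move/fwd/isoK.2.
- by case=> /(_ isT)/isoK.1 /bwd.
Qed.
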